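(* Let $G_1$ and $G_2$ be (weighted) directed graphs with distinguished vertices $x_0$ and $y_0$ respectively, and let $\delta\in\mathbb{R}$. Suppose that the graph wedge sum $G_1\vee G_2$ is formed by identifying $x_0$ with $y_0$, and that each of $x_0$ (in $G_1$) and $y_0$ (in $G_2$) shares a $\delta$-neighborhood with at least one other vertex. Then for every $n$, $$\tilde H_n(\mathfrak{D}_\delta(G_1\vee G_2))\cong \tilde H_n(\mathfrak{D}_\delta(G_1))\oplus\tilde H_n(\mathfrak{D}_\delta(G_2)).$$
   Context: A weighted directed graph (network) $G=(X,\omega)$ is a finite vertex set $X$ with $\omega:X\times X\to[0,\infty]$. The weight of a path $(x_0,\dots,x_m)$ is $\sum_i\omega(x_i,x_{i+1})$ ($0$ for a constant path), $d(x,y)$ is the infimum of the weights of paths from $x$ to $y$, and $P(G)=(X,d)$ is the path completion. $\mathfrak{D}_\delta(G)$ is the simplicial complex on $X$ whose simplices are the nonempty $\sigma\subseteq X$ for which there is $y\in X$ with $d(y,x)\le\delta$ for all $x\in\sigma$. The wedge sum $G_1\vee G_2$ is the disjoint union with $x_0$ and $y_0$ identified, keeping the weights within each $G_i$ and with weight $\infty$ between a vertex of $G_1\setminus\{x_0\}$ and a vertex of $G_2\setminus\{y_0\}$. A vertex $x$ of $G$ shares a $\delta$-neighborhood with another vertex $v\neq x$ if there is a vertex $y$ of $G$ with $d(y,x)\le\delta$ and $d(y,v)\le\delta$ (so $x$ is not an isolated vertex of $\mathfrak{D}_\delta(G)$). $\tilde H$ denotes reduced simplicial homology with real coefficients. 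*)

(* Defs.v *)
From HB Require Import structures.
From mathcomp Require Import all_boot all_order all_algebra.
From mathcomp Require Import all_classical all_reals all_analysis.
Set Implicit Arguments.
Unset Strict Implicit.
Unset Printing Implicit Defensive.
Import Order.TTheory GRing.Theory Num.Theory.
Local Open Scope classical_set_scope.
Local Open Scope ring_scope.
Local Open Scope quotient_scope.

Record wdigraph (R : realType) := WDigraph {
  vertex :> finType;
  weight : vertex -> vertex -> \bar R;
  weight_ge0 : forall x y, (0 <= weight x y)%E }.

Section PathDistance.
Variables (R : realType) (G : wdigraph R).

(* The path (x, p_0, ..., p_m) is encoded by its origin x and the list p. *)
Fixpoint path_weight (x : G) (p : seq G) : \bar R :=
  if p is y :: p' then (weight x y + path_weight y p')%E else 0%E.

Definition dist (x y : G) : \bar R :=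
  ereal_inf [set path_weight x p | p in [set p : seq G | last x p = y]].

Definition shares_nbhd (delta : R) (x v : G) : Prop :=
  exists y : G, (dist y x <= delta%:E)%E /\ (dist y v <= delta%:E)%E.

End PathDistance.

Section Wedge.
Variables (R : realType) (G1 G2 : wdigraph R) (x0 : G1) (y0 : G2).

(* The class of the identified vertices x0 ~ y0 is represented by [inl x0]. *)
Definition wedge_vertex : finType := (G1 + {y : G2 | y != y0})%type.

(* The loop at the identified vertex is the only pair receiving a weight from
   both graphs; it gets the smaller one.  Loops never affect [dist]. *)
Definition wedge_weight (u v : wedge_vertex) : \bar R :=
  match u, v with
  | inl x, inl x' =>
      if (x == x0) && (x' == x0) then Order.min (weight x0 x0) (weight y0 y0)
      else weight x x'
  | inl x, inr y => if x == x0 then weight y0 (val y) else +oo%E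
  | inr y, inl x => if x == x0 then weight (val y) y0 else +oo%E
  | inr y, inr y' => weight (val y) (val y')
  end.

Lemma wedge_weight_ge0 u v : (0 <= wedge_weight u v)%E.
Proof.
case: u v => [x|y] [x'|y'] /=; try by case: ifP => _;
  rewrite ?le_min ?weight_ge0 ?leey.
exact: weight_ge0.
Qed.

Definition wedge : wdigraph R := WDigraph wedge_weight_ge0.

End Wedge.

Record scomplex (X : finType) := SComplex {
  simplices :> {set {set X}};
  simplex_neq0 : forall s : {set X}, s \in simplices -> s != finset.set0;
  simplex_face : forall s t : {set X},
    s \in simplices -> t \subset s -> t != finset.set0 -> t \in simplices }.

Section Dowker.
Variables (R : realType) (delta : R) (G : wdigraph R).

Definition dowker_simplices : {set {set G}} :=
  [set s : {set G} | (s != finset.set0) &&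
     [exists y : G, [forall x in s, (dist y x <= delta%:E)%E]]]%SET.

Lemma dowker_neq0 (s : {set G}) : s \in dowker_simplices -> s != finset.set0.
Proof. by rewrite inE => /andP[]. Qed.

Lemma dowker_face (s t : {set G}) : s \in dowker_simplices -> t \subset s ->
  t != finset.set0 -> t \in dowker_simplices.
Proof.
rewrite !inE => /andP[_ /existsP[y /forall_inP ys]] /fintype.subsetP ts -> /=.
by apply/existsP; exists y; apply/forall_inP => x /ts /ys.
Qed.

Definition dowker : scomplex G := SComplex dowker_neq0 dowker_face.

End Dowker.

Section QuotientSpace.
Variables (F : fieldType) (V : vectType F) (U : {vspace V}).

Definition quot_space : Type := Quotient.quot (pred_of_vspace U).
HB.instance Definition _ := GRing.Zmodule.on quot_space.
HB.instance Definition _ := EqQuotient.on quot_space.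

Definition quot_scale (a : F) (q : quot_space) : quot_space :=
  \pi_(quot_space) (a *: repr q).

Lemma quot_eqP (u v : V) :
  reflect (\pi_(quot_space) u = \pi_(quot_space) v) (u - v \in U).
Proof. by rewrite [_ \in _](Quotient.idealrBE (pred_of_vspace U)); apply: eqP. Qed.

Lemma pi_quotD (u v : V) :
  \pi_(quot_space) (u + v) = \pi_(quot_space) u + \pi_(quot_space) v.
Proof. exact: (Quotient.pi_add (pred_of_vspace U)). Qed.

Lemma pi_quotZ (a : F) (u : V) :
  \pi_(quot_space) (a *: u) = quot_scale a (\pi_(quot_space) u).
Proof.
apply/quot_eqP; rewrite -scalerBr memvZ //.
by apply/quot_eqP; rewrite reprK.
Qed.

Fact quot_scaleA a b q : quot_scale a (quot_scale b q) = quot_scale (a * b) q.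
Proof.
rewrite -[q]reprK -(pi_quotZ b) -(pi_quotZ a) -(pi_quotZ (a * b)).
by rewrite scalerA.
Qed.
Fact quot_scale1 : left_id 1 quot_scale.
Proof. by move=> q; rewrite -[q]reprK -pi_quotZ scale1r. Qed.
Fact quot_scaleDr : right_distributive quot_scale +%R.
Proof.
move=> a q r; rewrite -[q]reprK -[r]reprK.
by rewrite -pi_quotD -(pi_quotZ a (_ + _)) -(pi_quotZ a (repr q))
  -(pi_quotZ a (repr r)) -pi_quotD scalerDr.
Qed.
Fact quot_scaleDl q : {morph quot_scale^~ q : a b / a + b}.
Proof.
move=> a b; rewrite -[q]reprK -(pi_quotZ (a + b)) -(pi_quotZ a) -(pi_quotZ b).
by rewrite -pi_quotD scalerDl.
Qed.

HB.instance Definition _ := GRing.Zmodule_isLmodule.Build F quot_space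
  quot_scaleA quot_scale1 quot_scaleDr quot_scaleDl.

End QuotientSpace.

Section ReducedHomology.
Variables (R : realType) (X : finType).

(* Formal linear combinations of subsets of X; a subset stands for the simplex
   oriented by the enumeration order of X. *)
Definition chain := {ffun {set X} -> R^o}.
HB.instance Definition _ := Vector.on chain.

Definition elem_chain (s : {set X}) : chain := [ffun t => (t == s)%:R].

Definition vertex_pos (s : {set X}) (v : X) : nat :=
  #|[set u in s | (enum_rank u < enum_rank v)%N]%SET|.

Definition elem_boundary (s : {set X}) : chain :=
  \sum_(v in s) (-1) ^+ vertex_pos s v *: elem_chain (s :\ v).

Definition boundary_fun (c : chain) : chain :=
  \sum_(s : {set X}) (c s : R) *: elem_boundary s.

Fact boundary_is_linear : linear boundary_fun.
Proof.
move=> a c c'; rewrite /boundary_fun scaler_sumr -big_split /=.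
by apply: eq_bigr => s _; rewrite !ffunE scalerDl scalerA.
Qed.
HB.instance Definition _ := GRing.isLinear.Build R chain chain *:%R
  boundary_fun boundary_is_linear.

Definition boundary : 'End(chain) := linfun boundary_fun.

Lemma boundary_funE s : boundary_fun (elem_chain s) = elem_boundary s.
Proof.
rewrite /boundary_fun (bigD1 s) //= ffunE eqxx scale1r big1 ?addr0 //.
by move=> t /negPf ts; rewrite ffunE ts scale0r.
Qed.

Lemma vertex_pos_rem (s : {set X}) v w : v \in s ->
  vertex_pos s w = ((enum_rank v < enum_rank w) + vertex_pos (s :\ v) w)%N.
Proof.
move=> vs; rewrite /vertex_pos (cardsD1 v) inE vs /=; congr (_ + _)%N.
by apply: eq_card => u; rewrite !inE andbA.
Qed.

Lemma boundary_funK c : boundary_fun (boundary_fun c) = 0.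
Proof.
rewrite [X in boundary_fun X]/boundary_fun linear_sum big1 //= => s _.
rewrite linearZ /= [X in _ *: X](_ : _ = 0) ?scaler0 //.
rewrite /elem_boundary linear_sum /=.
under eq_bigr do rewrite linearZ /= boundary_funE /elem_boundary scaler_sumr.
pose F v w : chain := (-1) ^+ vertex_pos s v *:
  ((-1) ^+ vertex_pos (s :\ v) w *: elem_chain (s :\ v :\ w)).
rewrite -[LHS]/(\sum_(v in s) \sum_(w in s :\ v) F v w).
have FC v w : v \in s -> w \in s -> w != v -> F v w = - F w v.
  move=> vs ws wv; rewrite /F !scalerA -!exprD -scaleNr.
  rewrite (vertex_pos_rem v ws) (vertex_pos_rem w vs).
  have -> : s :\ v :\ w = s :\ w :\ v.
    by rewrite finset.setDDl finset.setUC -finset.setDDl.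
  congr (_ *: _); rewrite !exprD.
  have : (enum_rank w < enum_rank v)%N = ~~ (enum_rank v < enum_rank w)%N.
    rewrite -leqNgt ltn_neqAle; case: eqP => // wv'.
    by rewrite (enum_rank_inj (ord_inj wv')) eqxx in wv.
  by case: (enum_rank v < enum_rank w)%N => ->; rewrite /= ?expr0 ?expr1;
     rewrite ?mul1r ?mulN1r ?mulNr ?opprK mulrC.
set S := LHS; have SN : S = - S.
  rewrite {1}/S (exchange_big_dep (mem s)) /=; last first.
    by move=> v w _; rewrite !inE => /andP[].
  rewrite /S -sumrN; apply: eq_bigr => w ws; rewrite -sumrN.
  apply: eq_big => [v|v /andP[vs]]; rewrite !inE.
    by rewrite ws andbT andbC eq_sym.
  by move=> /andP[wv _]; apply: FC.
apply/ffunP => t; move: (congr1 (fun c : chain => c t) SN) => /eqP.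
by rewrite !ffunE -subr_eq0 opprK -mulr2n mulrn_eq0 => /eqP.
Qed.

Variable K : scomplex X.

(* The complex is augmented by the empty simplex, which spans the chains of
   degree -1 and is the boundary of every vertex. *)
Definition simplices_of_dim (n : int) : {set {set X}} :=
  [set s : {set X} | ((s \in simplices K) || (s == finset.set0))
                     && (#|s|%:Z == n + 1)]%SET.

Definition chains (n : int) : {vspace chain} :=
  <<[seq elem_chain s | s in simplices_of_dim n]>>%VS.

Definition cycles (n : int) : {vspace chain} :=
  (chains n :&: lker boundary)%VS.

Definition boundaries (n : int) : {vspace chain} :=
  (boundary @: chains (n + 1))%VS.

Lemma boundaries_sub_cycles (n : int) : (boundaries n <= cycles n)%VS.
Proof.
rewrite subv_cap; apply/andP; split; last first.
  apply/subvP => _ /memv_imgP[c _ ->].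
  by rewrite memv_ker !lfunE /= boundary_funK.
rewrite /boundaries /chains limg_span; apply/span_subvP => c'.
move=> /mapP[c /mapP[s]]; rewrite mem_enum inE => /andP[Ks /eqP sn] -> ->.
rewrite lfunE /= boundary_funE; apply: memv_suml => v vs; apply: memvZ.
apply: memv_span; apply: map_f; rewrite mem_enum inE.
apply/andP; split; last first.
  apply/eqP/(addIr 1); rewrite -sn (cardsD1 v s) vs addrC.
  by rewrite -PoszD.
case: (eqVneq (s :\ v) finset.set0) => [|v0] //=; first by rewrite orbT.
case/orP: Ks => [Ks|/eqP s0]; last by rewrite s0 inE in vs.
by rewrite (simplex_face Ks) ?subD1set.
Qed.

(* Cycles modulo boundaries, the latter pulled back along the inclusion of the
   cycles. *)
Definition reduced_homology (n : int) :=
  quot_space (linfun (vsval : subvs_of (cycles n) -> chain)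
                @^-1: boundaries n)%VS.
HB.instance Definition _ n := GRing.Lmodule.on (reduced_homology n).

End ReducedHomology.

(* Main.v *)
From HB Require Import structures.
Require Import Defs.
From mathcomp Require Import all_boot all_order all_algebra.
From mathcomp Require Import all_classical all_reals all_analysis.
From mathcomp Require Import ring.
Set Implicit Arguments.
Unset Strict Implicit.
Unset Printing Implicit Defensive.
Import Order.TTheory GRing.Theory Num.Theory.
Local Open Scope ring_scope.

(* The inclusions i_k of G_k in the wedge W and the retractions r_k of W onto
   G_k (collapsing the other graph to the wedge point w) do not increase path
   distances, so they are simplicial for the Dowker complexes.  On homology,
   (r_1, r_2) and (i_1, i_2) are mutually inverse.  The composites r_k i_l with
   k != l are constant, hence zero on reduced homology.  For the other
   direction, consider the chain map T = id - i_1 r_1 - i_2 r_2.  A simplex s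
   of D(W) that meets both graphs outside w spans a simplex with w, because a
   path from one graph to the other passes through w; and if s lies in one of
   the graphs, then T s is supported on the empty simplex and {w}.  So T maps
   chains of D(W) to chains c whose cone w * c is still in D(W), and for a
   cycle z one gets T z = boundary (w * T z). *)

(** * Linear maps on chains, determined by their values on simplices *)

Section LinearExtension.
Variables (R : realType) (X Y : finType).
Implicit Types (c : chain R X) (F : {set X} -> chain R Y).

Definition lin_ext F c : chain R Y := \sum_(s : {set X}) (c s : R) *: F s.

Fact lin_ext_is_linear F : linear (lin_ext F).
Proof.
move=> a c c'; rewrite /lin_ext scaler_sumr -big_split /=.
by apply: eq_bigr => s _; rewrite !ffunE scalerDl scalerA.
Qed.
HB.instance Definition _ F := GRing.isLinear.Build R (chain R X) (chain R Y)
  *:%R (lin_ext F) (lin_ext_is_linear F).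

Lemma lin_extE F s : lin_ext F (elem_chain R s) = F s.
Proof.
rewrite /lin_ext (bigD1 s) //= ffunE eqxx scale1r big1 ?addr0 //.
by move=> t /negPf ts; rewrite ffunE ts scale0r.
Qed.

Lemma chain_decomp c : c = \sum_(s : {set X}) (c s : R) *: elem_chain R s.
Proof.
apply/ffunP => t; rewrite sum_ffunE (bigD1 t) //= !ffunE eqxx.
rewrite [_ *: _]mulr1 big1 ?addr0 // => s st.
by rewrite !ffunE eq_sym (negPf st) scaler0.
Qed.

Lemma eq_linear_chain (f g : {linear chain R X -> chain R Y}) :
  (forall s, f (elem_chain R s) = g (elem_chain R s)) -> f =1 g.
Proof.
move=> fg c; rewrite [c]chain_decomp !linear_sum /=.
by apply: eq_bigr => s _; rewrite !linearZ /= fg.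
Qed.

End LinearExtension.

(** * Cones as exterior multiplication by a vertex, and ordered simplices *)

Section Cone.
Variables (R : realType) (X : finType).
Implicit Types (s : {set X}) (v w : X) (c : chain R X).

Lemma vertex_posU1 s v w : v \notin s ->
  vertex_pos (v |: s) w = ((enum_rank v < enum_rank w) + vertex_pos s w)%N.
Proof.
by move=> vs; rewrite (vertex_pos_rem w (finset.setU11 v s)) finset.setU1K.
Qed.

Lemma vertex_pos_remid s v : vertex_pos (s :\ v) v = vertex_pos s v.
Proof.
case: (boolP (v \in s)) => [vs|vs]; first by rewrite (vertex_pos_rem v vs) ltnn.
by congr vertex_pos; apply/finset.setDidPl; rewrite disjoint_sym disjoints1.
Qed.

Lemma enum_rank_ltC v w : v != w ->
  (enum_rank w < enum_rank v)%N = ~~ (enum_rank v < enum_rank w)%N.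
Proof.
move=> vw; rewrite -leqNgt ltn_neqAle; case: eqP => // wv.
by rewrite (enum_rank_inj (ord_inj wv)) eqxx in vw.
Qed.

(* Chains form the exterior algebra on X, and [elem_cone v s] is the exterior
   product of [v] with the oriented simplex [s]. *)
Definition elem_cone v s : chain R X :=
  if v \in s then 0 else (-1) ^+ vertex_pos s v *: elem_chain R (v |: s).

Definition cone v : chain R X -> chain R X := lin_ext (elem_cone v).
HB.instance Definition _ v := GRing.Linear.on (cone v).

Lemma coneE v s : cone v (elem_chain R s) = elem_cone v s.
Proof. exact: lin_extE. Qed.

Lemma coneZE v a s : cone v (a *: elem_chain R s) = a *: elem_cone v s.
Proof. by rewrite linearZ /= coneE. Qed.

Lemma signZK (V : lmodType R) n (c : V) :
  (-1) ^+ n *: ((-1) ^+ n *: c) = c.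
Proof. by rewrite scalerA -expr2 sqrr_sign scale1r. Qed.

(** The cone is a contracting homotopy of the full augmented complex; equivalently, the boundary is
    an antiderivation of the exterior algebra that sends every vertex to 1. *)
Lemma boundary_cone v c :
  boundary_fun (cone v c) = c - cone v (boundary_fun c).
Proof.
have -> : cone v (boundary_fun c) = (cone v \o @boundary_fun R X) c by [].
suff: @boundary_fun R X \o cone v =1 idfun \- (cone v \o @boundary_fun R X).
  exact.
apply: eq_linear_chain => s /=.
rewrite coneE boundary_funE /elem_boundary (linear_sum (cone v)) /= /elem_cone.
(* If [v] lies in [s], the cone of [s] is 0 and only the face opposite [v] has a nonzero cone, which
   is [s] itself: the same sign occurs twice. *)
case: ifP => vs.
  rewrite linear0 (bigD1 v) //= coneZE /elem_cone finset.setD11.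
  rewrite vertex_pos_remid signZK finset.setD1K // big1 ?addr0 ?subrr //.
  move=> w /andP[ws wv]; rewrite coneZE /elem_cone.
  by rewrite !inE eq_sym wv vs scaler0.
(* Otherwise the face of [v |: s] opposite [v] gives [s], and each remaining face cancels against
   the cone of a face of [s]. *)
rewrite linearZ /= boundary_funE /elem_boundary big_setU1 ?vs //=.
rewrite vertex_posU1 ?vs // ltnn add0n finset.setU1K ?vs // scalerDr signZK.
congr (_ + _); rewrite scaler_sumr -sumrN; apply: eq_bigr => w ws.
have vw : v != w by apply: contraFneq vs => ->.
rewrite coneZE /elem_cone !inE vs andbF !scalerA -scaleNr.
have -> : (v |: s) :\ w = v |: (s :\ w).
  apply/finset.setP => u; rewrite !inE; case: (eqVneq u w) vw => // ->.
  by rewrite eq_sym => /negPf->.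
congr (_ *: _); rewrite -!exprD vertex_posU1 ?vs // (vertex_pos_rem v ws).
(* Exactly one of [v], [w] precedes the other, so the two exponents differ in parity. *)
rewrite (enum_rank_ltC vw) !exprD.
by case: (_ < _)%N; rewrite /= ?expr0 ?expr1; ring.
Qed.

Lemma coneC v w c : cone v (cone w c) = - cone w (cone v c).
Proof.
suff: cone v \o cone w =1 \- (cone w \o cone v) by exact.
apply: eq_linear_chain => s /=; rewrite !coneE /elem_cone.
case: (eqVneq v w) => [<-|vw].
  case: ifP => vs; first by rewrite linear0 oppr0.
  by rewrite coneZE /elem_cone finset.setU11 scaler0 oppr0.
case: ifP => ws; case: ifP => vs; rewrite ?linear0 ?oppr0 //.
- by rewrite coneZE /elem_cone finset.setU1r // scaler0 oppr0.
- by rewrite coneZE /elem_cone finset.setU1r // scaler0.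
rewrite !coneZE /elem_cone !inE (negPf vw) eq_sym (negPf vw) ws vs /=.
rewrite finset.setUCA !scalerA -scaleNr !vertex_posU1 ?vs ?ws //.
rewrite (enum_rank_ltC vw); congr (_ *: _); rewrite !exprD.
by case: (_ < _)%N; rewrite /= ?expr0 ?expr1; ring.
Qed.

(** The exterior product of the vertices of [l] in the given order, so that reordering signs and
    degenerate simplices need no separate treatment. *)
Definition simplex_of_seq (l : seq X) : chain R X :=
  foldr cone (elem_chain R finset.set0) l.

(** Each vertex coned on precedes all those already present, so every sign is 1. *)
Lemma simplex_of_seq_sorted (l : seq X) :
  sorted (fun v w => enum_rank v < enum_rank w)%N l ->
  simplex_of_seq l = elem_chain R [set x in l]%SET.
Proof.
elim: l => [_|v l IHl] /=; first by rewrite finset.set_nil.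
move=> vl; have lt_l w : w \in l -> (enum_rank v < enum_rank w)%N.
  have tr : transitive (fun v w : X => enum_rank v < enum_rank w)%N.
    by move=> ? ? ?; apply: ltn_trans.
  by move=> wl; move: (order_path_min tr vl) => /allP; apply.
rewrite /= -/(simplex_of_seq l) IHl ?(path_sorted vl) // coneE /elem_cone inE.
case: ifP => [/lt_l|_]; first by rewrite ltnn.
rewrite /vertex_pos finset.set_cons (_ : [set _ in _ | _]%SET = finset.set0).
  by rewrite finset.cards0 scale1r.
apply/finset.setP => u; rewrite !inE; apply: contraTF isT => /andP[/lt_l vu uv].
by move: (ltn_trans vu uv); rewrite ltnn.
Qed.

Lemma enum_set_sorted s :
  sorted (fun v w => enum_rank v < enum_rank w)%N (enum s).
Proof.
have tr : transitive (fun v w : X => enum_rank v < enum_rank w)%N.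
  by move=> ? ? ?; apply: ltn_trans.
rewrite /enum_mem; apply: sorted_filter => //; rewrite -enumT.
have [->//|[x0 _]] : enum X = [::] \/ exists x0 : X, True.
  by case: (enum X) => [|x0 l]; [left | right; exists x0].
have rank_nth i : (i < size (enum X))%N ->
    enum_rank (nth x0 (enum X) i) = i :> nat.
  rewrite -cardE => iX.
  by rewrite -(@enum_val_nth _ _ x0 (Ordinal iX)) enum_valK.
by apply/(sortedP x0) => i iX; rewrite !rank_nth // ltnW.
Qed.

Lemma simplex_of_enum s : simplex_of_seq (enum s) = elem_chain R s.
Proof.
rewrite simplex_of_seq_sorted ?enum_set_sorted //; congr elem_chain.
by apply/finset.setP => u; rewrite inE mem_enum.
Qed.

(** Moving [v] to the front crosses each vertex of [l1] once, at the cost of one sign by [coneC]. *)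
Lemma simplex_of_seq_mid (l1 l2 : seq X) v :
  simplex_of_seq (l1 ++ v :: l2) =
  (-1) ^+ size l1 *: simplex_of_seq (v :: l1 ++ l2).
Proof.
elim: l1 => [|w l1 IHl]; first by rewrite scale1r.
rewrite /= -/(simplex_of_seq _) IHl linearZ /= coneC scalerN exprS mulN1r.
by rewrite scaleNr.
Qed.

Lemma cone_mem v (l : seq X) : v \in l -> cone v (simplex_of_seq l) = 0.
Proof.
(* By anticommutativity the double cone equals its own opposite, hence vanishes over the reals. *)
have coneK c : cone v (cone v c) = 0.
  apply/eqP; have := coneC v v c => /eqP; rewrite -subr_eq0 opprK -mulr2n.
  by rewrite -scaler_nat scaler_eq0 pnatr_eq0.
elim: l => // w l IHl; rewrite inE /= => /orP[/eqP<-|/IHl vl].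
  exact: coneK.
by rewrite coneC vl linear0 oppr0.
Qed.

(** The coefficient is a product of signs, replaced by 0 as soon as a vertex repeats. *)
Lemma simplex_of_seq_uniq (l : seq X) : exists a : R,
  simplex_of_seq l = a *: elem_chain R [set x in l]%SET /\ (a != 0 -> uniq l).
Proof.
elim: l => [|v l [a [la ul]]].
  by exists 1; rewrite finset.set_nil scale1r.
rewrite /= la coneZE /elem_cone inE.
case: ifP => vl; first by exists 0; rewrite scaler0 scale0r eqxx.
exists (a * (-1) ^+ vertex_pos [set x in l]%SET v).
rewrite finset.set_cons scalerA; split=> //.
by rewrite mulf_eq0 signr_eq0 orbF => /ul.
Qed.

End Cone.

(** * The chain map induced by a map of vertices *)

Section Pushforward.
Variables (R : realType) (X Y : finType) (f : X -> Y).
Implicit Types (s : {set X}) (v : X) (c : chain R X).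

(** The map of exterior algebras induced by [f]: a simplex on which [f] is not injective goes to 0,
    and orientation signs come from the exterior product. *)
Definition push : chain R X -> chain R Y :=
  lin_ext (fun s => simplex_of_seq R (map f (enum s))).
HB.instance Definition _ := GRing.Linear.on push.

Lemma pushE s : push (elem_chain R s) = simplex_of_seq R (map f (enum s)).
Proof. exact: lin_extE. Qed.

Lemma enum_setU1 s v : v \notin s -> exists l1 l2,
  enum (v |: s) = l1 ++ v :: l2 /\ enum s = l1 ++ l2.
Proof.
move=> vs; have : v \in enum (v |: s) by rewrite mem_enum finset.setU11.
have mem_e u : u \in enum (v |: s) = (u == v) || (u \in s).
  by rewrite mem_enum !inE.
have : enum s = seq.filter (mem s) (enum (v |: s)).
  rewrite -filter_predI; apply: eq_filter => u /=; rewrite !inE.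
  by case: (u \in s); rewrite ?orbT ?andbF.
move=> es /splitPr E; move: es mem_e (enum_uniq (v |: s)).
case: E => l1 l2 -> mem_e; rewrite cat_uniq /= => /and4P[_ vl1 vl2 _].
exists l1, l2; split=> //; rewrite filter_cat /= (negPf vs).
move: vl1; rewrite negb_or => /andP[vl1 _].
congr (_ ++ _); apply/all_filterP/allP => u ul /=.
  have /esym := mem_e u; rewrite mem_cat ul /= => /orP[/eqP uv|//].
  by rewrite -uv ul in vl1.
have /esym := mem_e u; rewrite mem_cat inE ul !orbT /= => /orP[/eqP uv|//].
by rewrite -uv ul in vl2.
Qed.

(** This is multiplicativity of [push]. For [v] outside [s], inserting [v] at its place in the
    enumeration costs the same sign before and after applying [f]. *)
Lemma push_cone v c : push (cone v c) = cone (f v) (push c).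
Proof.
suff: push \o cone v =1 cone (f v) \o push by exact.
apply: eq_linear_chain => s /=; rewrite pushE.
case: (boolP (v \in s)) => vs.
  by rewrite coneE /elem_cone vs linear0 cone_mem // map_f // mem_enum.
have [l1 [l2 [eU es]]] := enum_setU1 vs.
have -> : cone v (elem_chain R s) = (-1) ^+ size l1 *: elem_chain R (v |: s).
  by rewrite -!simplex_of_enum eU simplex_of_seq_mid signZK es.
rewrite linearZ /= pushE eU es map_cat /= simplex_of_seq_mid size_map signZK.
by rewrite map_cat.
Qed.

Lemma push_seq l : push (simplex_of_seq R l) = simplex_of_seq R (map f l).
Proof.
elim: l => [|v l IHl] /=; first by rewrite pushE enum_set0.
by rewrite push_cone IHl.
Qed.

Lemma boundary_fun0 (Z : finType) :
  boundary_fun (elem_chain R (finset.set0 : {set Z})) = 0.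
Proof. by rewrite boundary_funE /elem_boundary finset.big_set0. Qed.

Lemma push_boundary c : push (boundary_fun c) = boundary_fun (push c).
Proof.
suff: push \o @boundary_fun R X =1 @boundary_fun R Y \o push by exact.
apply: eq_linear_chain => s /=; rewrite -simplex_of_enum.
(* Building the simplex by cones reduces the claim to [boundary_cone] on both sides, so no sign has
   to be computed. *)
elim: (enum s) => [|v l IHl] /=.
  by rewrite pushE enum_set0 !boundary_fun0 linear0.
by rewrite push_cone !boundary_cone linearB /= push_cone IHl.
Qed.

End Pushforward.

Lemma push_comp (R : realType) (X Y Z : finType) (f : X -> Y) (g : Y -> Z)
  (c : chain R X) : push g (push f c) = push (g \o f) c.
Proof.
suff: @push R _ _ g \o push f =1 push (g \o f) by exact.
by apply: eq_linear_chain => s /=; rewrite !pushE push_seq map_comp.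
Qed.

Lemma push_elem_id (R : realType) (X : finType) (f : X -> X) (s : {set X}) :
  {in s, f =1 id} -> push f (elem_chain R s) = elem_chain R s.
Proof.
move=> fs; rewrite pushE map_id_in ?simplex_of_enum // => x.
by rewrite mem_enum => /fs.
Qed.

Lemma push_id (R : realType) (X : finType) (f : X -> X) (c : chain R X) :
  f =1 id -> push f c = c.
Proof.
move=> f_id; suff: push f =1 (idfun : chain R X -> chain R X) by exact.
by apply: eq_linear_chain => s; apply: push_elem_id => x _; apply: f_id.
Qed.

(** * Chains supported on a family of simplices *)

Section Support.
Variables (R : realType).
Implicit Types (X Y : finType).

Definition supported X (P : {set X} -> Prop) (c : chain R X) :=
  forall s, c s != 0 -> P s.

Lemma supported0 X (P : {set X} -> Prop) : supported P 0.
Proof. by move=> s; rewrite ffunE eqxx. Qed.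

Lemma supportedD X (P : {set X} -> Prop) c c' :
  supported P c -> supported P c' -> supported P (c + c').
Proof.
move=> Pc Pc' s; rewrite ffunE; case: (eqVneq (c s) 0) => [->|/Pc//].
by rewrite add0r; apply: Pc'.
Qed.

Lemma supportedZ X (P : {set X} -> Prop) a c :
  supported P c -> supported P (a *: c).
Proof.
move=> Pc s; rewrite ffunE; case: (eqVneq (c s) 0) => [->|/Pc//].
by rewrite scaler0 eqxx.
Qed.

Lemma supportedN X (P : {set X} -> Prop) c :
  supported P c -> supported P (- c).
Proof. by rewrite -scaleN1r; apply: supportedZ. Qed.

Lemma supported_elem X (P : {set X} -> Prop) s :
  P s -> supported P (elem_chain R s).
Proof.
by move=> Ps t; rewrite ffunE; case: (eqVneq t s) => [->|_] //; rewrite eqxx.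
Qed.

Lemma supported_linear X Y (P : {set X} -> Prop) (Q : {set Y} -> Prop)
    (g : {linear chain R X -> chain R Y}) (c : chain R X) :
    (forall s, P s -> supported Q (g (elem_chain R s))) ->
  supported P c -> supported Q (g c).
Proof.
move=> PQ Pc; rewrite [c]chain_decomp linear_sum /=.
apply: (big_ind (supported Q)) => [||s _].
- exact: supported0.
- exact: supportedD.
rewrite linearZ /=; case: (eqVneq (c s) 0) => [->|/Pc/PQ].
  by rewrite scale0r; apply: supported0.
exact: supportedZ.
Qed.

Lemma supported_cone X (P Q : {set X} -> Prop) v (c : chain R X) :
    (forall s, P s -> v \notin s -> Q (v |: s)) ->
  supported P c -> supported Q (cone v c).
Proof.
move=> PQ; apply: (supported_linear (g := cone v)) => s Ps /=.
rewrite coneE /elem_cone.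
case: ifPn => vs; first exact: supported0.
by apply: supportedZ; apply: supported_elem; apply: PQ.
Qed.

(** Simplices that lose dimension under [f] are sent to 0, so [Q] has to be checked only when the
    cardinality is preserved. *)
Lemma supported_push_elem X Y (f : X -> Y) (Q : {set Y} -> Prop)
    (s : {set X}) :
  (#|f @: s| = #|s| -> Q (f @: s)) -> supported Q (push f (elem_chain R s)).
Proof.
move=> Qs; rewrite pushE.
have [a [-> ua]] := simplex_of_seq_uniq R (map f (enum s)).
have [->|/ua fs] := eqVneq a 0; first by rewrite scale0r; apply: supported0.
have fsE : [set x in [seq f i | i <- enum s]]%SET = f @: s.
  apply/finset.setP => y; rewrite inE; apply/mapP/imsetP => -[x xs ->].
    by exists x; rewrite // -mem_enum.
  by exists x; rewrite // mem_enum.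
apply: supportedZ; apply: supported_elem; rewrite fsE; apply: Qs.
by rewrite -fsE cardsE (card_uniqP fs) size_map -cardE.
Qed.

End Support.

(** * Cycles, boundaries and homology classes *)

Section Homology.
Variables (R : realType) (X : finType) (K : scomplex X).
Implicit Types (n : int) (c z : chain R X).

Lemma mem_chainsP n c :
  c \in chains R K n <-> supported (fun s => s \in simplices_of_dim K n) c.
Proof.
split=> [|Kc].
  rewrite /chains -[X in span X]/(val (in_tuple _)) => /coord_span -> s.
  apply: contra_neqT => sK; rewrite sum_ffunE big1 // => i _; rewrite ffunE.
  have : (in_tuple [seq elem_chain R s | s in simplices_of_dim K n])`_i
     \in [seq elem_chain R s | s in simplices_of_dim K n] by apply: mem_nth.
  case/mapP => t; rewrite mem_enum => tK ->; rewrite ffunE.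
  by case: eqVneq sK => [->|_ _]; rewrite ?tK // scaler0.
rewrite [c]chain_decomp; apply: memv_suml => s _.
have [->|/Kc sK] := eqVneq (c s) 0; first by rewrite scale0r mem0v.
by apply/memvZ/memv_span/map_f; rewrite mem_enum.
Qed.

Lemma mem_cyclesP n c :
  c \in cycles R K n <-> c \in chains R K n /\ boundary_fun c = 0.
Proof.
rewrite memv_cap memv_ker lfunE /=.
by split=> [/andP[-> /eqP]|[-> /eqP]].
Qed.

Lemma mem_boundariesP n c : c \in boundaries R K n <->
  exists2 b, b \in chains R K (n + 1) & c = boundary_fun b.
Proof.
split=> [/memv_imgP[b bK ->]|[b bK ->]]; first by exists b; rewrite ?lfunE.
by rewrite -[boundary_fun b](lfunE (@boundary_fun R X)) memv_img.
Qed.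

(** The filling is [cone v z]: the support condition keeps it inside [K], and its boundary is [z]
    because the correction term is the cone of the boundary of [z]. *)
Lemma cone_boundary n (v : X) z :
    supported (fun s => v |: s \in simplices K /\ #|s|%:Z = n + 1) z ->
  boundary_fun z = 0 -> z \in boundaries R K n.
Proof.
move=> Kz z0; apply/mem_boundariesP; exists (cone v z); last first.
  by rewrite boundary_cone z0 linear0 subr0.
apply/mem_chainsP; apply: supported_cone Kz => s [sK sn] vs.
by rewrite inE sK cardsU1 vs PoszD sn addrC /=.
Qed.

(** [vsproj] makes this total and linear in [z]; on cycles it is the identity, and only there is the
    value meaningful. *)
Definition homology_class n z : reduced_homology R K n :=
  \pi_(quot_space _)%qT (vsproj (cycles R K n) z).

Lemma homology_class_ex n (q : reduced_homology R K n) :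
  exists2 z, z \in cycles R K n & q = homology_class n z.
Proof.
exists (vsval (repr q)); first exact: subvsP.
by rewrite /homology_class vsvalK reprK.
Qed.

Lemma homology_class_eq n z z' :
    z \in cycles R K n -> z' \in cycles R K n ->
  homology_class n z = homology_class n z' <-> z - z' \in boundaries R K n.
Proof.
move=> zK zK'; rewrite /homology_class.
have -> : (z - z' \in boundaries R K n) =
  (vsproj (cycles R K n) z - vsproj (cycles R K n) z' \in
   (linfun (vsval : subvs_of (cycles R K n) -> chain R X)
                @^-1: boundaries R K n)%VS).
  by rewrite -memv_preim lfunE linearB /= !vsprojK.
by split=> [/quot_eqP|H]; [|apply/quot_eqP].
Qed.

Lemma homology_classP n a z z' : homology_class n (a *: z + z') =
  a *: homology_class n z + homology_class n z'.
Proof. by rewrite /homology_class linearP /= pi_quotD pi_quotZ. Qed.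

Lemma homology_classD n z z' : homology_class n (z + z') =
  homology_class n z + homology_class n z'.
Proof. by rewrite -[z in LHS]scale1r homology_classP scale1r. Qed.

Lemma homology_class0 n z : z \in boundaries R K n -> homology_class n z = 0.
Proof.
move=> zB; have -> : 0 = homology_class n 0.
  rewrite -[0 in RHS](subrr 0) -scaleN1r addrC homology_classP.
  by rewrite scaleN1r addNr.
apply/homology_class_eq; rewrite ?mem0v ?subr0 //.
exact: (subvP (boundaries_sub_cycles R K n)).
Qed.

End Homology.

(** * Maps induced on reduced homology *)

Lemma linear_ex (R : pzRingType) (U V : lmodType R) (f : U -> V) :
  linear f -> exists g : {linear U -> V}, g =1 f.
Proof.
move=> lin_f; pose m := GRing.isLinear.Build R U V *:%R f lin_f.
pose g : {linear U -> V} := HB.pack f m; by exists g.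
Qed.

Lemma homology_map_ex (R : realType) (X Y : finType) (K : scomplex X)
    (L : scomplex Y) (n : int) (g : {linear chain R X -> chain R Y}) :
    (forall z, z \in cycles R K n -> g z \in cycles R L n) ->
    (forall z, z \in boundaries R K n -> g z \in boundaries R L n) ->
  exists h : {linear reduced_homology R K n -> reduced_homology R L n},
    forall z, z \in cycles R K n ->
      h (homology_class K n z) = homology_class L n (g z).
Proof.
move=> gZ gB.
(* The map is defined on a chosen representative; [hE] shows independence of the choice, since two
   representatives differ by a boundary and [g] preserves boundaries. *)
pose h (q : reduced_homology R K n) := homology_class L n (g (vsval (repr q))).
have hE z : z \in cycles R K n ->
    h (homology_class K n z) = homology_class L n (g z).
  move=> zK; apply/(homology_class_eq (n := n)); rewrite ?gZ ?subvsP //.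
  rewrite -linearB gB //.
  apply/(homology_class_eq (n := n)); rewrite ?subvsP //.
  by rewrite {1}/homology_class vsvalK reprK.
have lin_h : linear h.
  move=> a q q'; have [z zK ->] := homology_class_ex q.
  have [z' zK' ->] := homology_class_ex q'.
  by rewrite -homology_classP !hE ?memvD ?memvZ // -homology_classP linearP.
by have [k kE] := linear_ex lin_h; exists k => z zK; rewrite kE hE.
Qed.

Section SimplicialMap.
Variables (X Y : finType) (K : scomplex X) (L : scomplex Y) (f : X -> Y).

Definition simplicial_map : Prop :=
  forall s : {set X}, s \in simplices K -> f @: s \in simplices L.

Hypothesis fKL : simplicial_map.
Variables (R : realType) (n : int).
Implicit Types (c z : chain R X).

Lemma push_chains m c : c \in chains R K m -> push f c \in chains R L m.
Proof.
move=> /mem_chainsP Kc; apply/mem_chainsP.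
apply: (supported_linear (g := push f)) Kc => s /=.
rewrite inE => /andP[sK sn]; apply: supported_push_elem => fs.
rewrite inE fs sn andbT; case/orP: sK => [/fKL->//|/eqP->].
by rewrite imset0 eqxx orbT.
Qed.

Lemma push_cycles z : z \in cycles R K n -> push f z \in cycles R L n.
Proof.
move=> /mem_cyclesP[zK z0]; apply/mem_cyclesP; split; first exact: push_chains.
by rewrite -push_boundary z0 linear0.
Qed.

Lemma push_boundaries z :
  z \in boundaries R K n -> push f z \in boundaries R L n.
Proof.
move=> /mem_boundariesP[b bK ->]; apply/mem_boundariesP.
by exists (push f b); rewrite ?push_boundary // push_chains.
Qed.

Lemma homology_push_ex :
  exists h : {linear reduced_homology R K n -> reduced_homology R L n},
    forall z, z \in cycles R K n ->
      h (homology_class K n z) = homology_class L n (push f z).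
Proof.
exact: (homology_map_ex (g := push f)) push_cycles push_boundaries.
Qed.

End SimplicialMap.

(** The reduced homology of a point vanishes, in degree -1 too: the image is supported on the empty
    simplex and the vertex [y], and can be coned off at [y]. *)
Lemma push_const_boundary (R : realType) (X Y : finType) (K : scomplex X)
    (L : scomplex Y) (f : X -> Y) y n (z : chain R X) :
    (forall x, f x = y) -> [set y]%SET \in simplices L ->
  z \in cycles R K n -> push f z \in boundaries R L n.
Proof.
move=> fy yL /mem_cyclesP[/mem_chainsP zK z0].
apply: (cone_boundary (v := y)); last by rewrite -push_boundary z0 linear0.
apply: (supported_linear (g := push f)) zK => s /=.
rewrite inE => /andP[_ /eqP sn].
apply: supported_push_elem => fs; split; last by rewrite fs.
suff /finset.setUidPl-> : f @: s \subset [set y]%SET by [].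
by apply/fintype.subsetP => _ /imsetP[x _ ->]; rewrite inE fy.
Qed.

(** * Splitting of homology for abstract simplicial retracts meeting in a point *)

Section WedgeHomology.
Variables (R : realType) (W X1 X2 : finType).
Variables (K : scomplex W) (K1 : scomplex X1) (K2 : scomplex X2).
Variables (w0 : W) (x0 : X1) (y0 : X2).
Variables (i1 : X1 -> W) (i2 : X2 -> W) (r1 : W -> X1) (r2 : W -> X2).
Hypotheses (i1K : simplicial_map K1 K i1) (i2K : simplicial_map K2 K i2)
  (r1K : simplicial_map K K1 r1) (r2K : simplicial_map K K2 r2).
Hypotheses (r1i1 : r1 \o i1 =1 id) (r2i2 : r2 \o i2 =1 id)
  (r1i2 : forall y, r1 (i2 y) = x0) (r2i1 : forall x, r2 (i1 x) = y0)
  (i1x0 : i1 x0 = w0) (i2y0 : i2 y0 = w0).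
Hypotheses (x0K : [set x0]%SET \in simplices K1)
  (y0K : [set y0]%SET \in simplices K2).
Hypothesis side : forall u,
  i1 (r1 u) = u /\ r2 u = y0 \/ i2 (r2 u) = u /\ r1 u = x0.
Hypothesis mixed : forall s : {set W}, s \in simplices K ->
  [\/ w0 |: s \in simplices K,
      {in s, forall u, i1 (r1 u) = u /\ r2 u = y0} |
      {in s, forall u, i2 (r2 u) = u /\ r1 u = x0}].

Lemma wedge_defect_boundary n z : z \in cycles R K n ->
  z - push (i1 \o r1) z - push (i2 \o r2) z \in boundaries R K n.
Proof.
move=> /mem_cyclesP[/mem_chainsP zK z0].
have w0K : [set w0]%SET \in simplices K by rewrite -i1x0 -imset_set1 i1K.
apply: (cone_boundary (v := w0)); last first.
  by rewrite !linearB /= -!push_boundary z0 !linear0 !addr0.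
pose coned (t : {set W}) := w0 |: t \in simplices K /\ #|t|%:Z = n + 1.
pose T :=
  ((idfun : chain R W -> chain R W) \- push (i1 \o r1)) \- push (i2 \o r2).
apply: (supported_linear (g := T)) zK => s /=; rewrite inE => /andP[sK /eqP sn].
have push_const (f : W -> W) : {in s, forall u, f u = w0} ->
    supported coned (push f (elem_chain R s)).
  move=> fs; apply: supported_push_elem => fsE; split; last by rewrite fsE.
  suff /finset.setUidPl-> : f @: s \subset [set w0]%SET by [].
  by apply/fintype.subsetP => _ /imsetP[x xs ->]; rewrite inE fs.
(* [mixed] speaks of nonempty simplices; the empty one, present by augmentation, falls into the
   first case since [w0] is a vertex of [K]. *)
have [w0s|sl|sr] : [\/ w0 |: s \in simplices K,
      {in s, forall u, i1 (r1 u) = u /\ r2 u = y0} |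
      {in s, forall u, i2 (r2 u) = u /\ r1 u = x0}].
- by case/orP: sK => [/mixed//|/eqP->]; constructor 1; rewrite finset.setU0.
(* By [side], both composites fix a vertex or move it to [w0], so the image of [s] stays within the
   simplex [w0 |: s]. *)
- have push_s (f : W -> W) : (forall u, f u = u \/ f u = w0) ->
    supported coned (push f (elem_chain R s)).
    move=> fu; apply: supported_push_elem => fsE; split; last by rewrite fsE.
    apply: simplex_face w0s _ _; last first.
      by apply/finset.set0Pn; exists w0; apply: finset.setU11.
    apply/fintype.subsetP => u; rewrite !inE => /orP[->//|/imsetP[v vs ->]].
    by case: (fu v) => ->; rewrite ?vs ?eqxx ?orbT.
  apply: supportedD; last first.
    apply: supportedN; apply: push_s => u /=.
    by case: (side u) => -[E1 E2]; [right; rewrite E2|left].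
  apply: supportedD; last first.
    apply: supportedN; apply: push_s => u /=.
    by case: (side u) => -[E1 E2]; [left|right; rewrite E2].
  by apply: supported_elem.
(* On the left side the first composite fixes [s] and cancels it, while the second is constant at
   [w0]; the right side is symmetric. *)
- rewrite push_elem_id => [|u /sl[]//]; rewrite subrr sub0r.
  by apply: supportedN; apply: push_const => u /sl[_ /= ->].
- rewrite (@push_elem_id _ _ (i2 \o r2)) => [|u /sr[]//].
  rewrite addrAC subrr sub0r.
  by apply: supportedN; apply: push_const => u /sr[_ /= ->].
Qed.

Lemma wedge_homology n :
  exists f : {linear reduced_homology R K n ->
                     (reduced_homology R K1 n * reduced_homology R K2 n)%type},
    bijective f.
Proof.
have [h1 h1E] := homology_push_ex r1K R n.
have [h2 h2E] := homology_push_ex r2K R n.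
have [k1 k1E] := homology_push_ex i1K R n.
have [k2 k2E] := homology_push_ex i2K R n.
have [f fE] : exists f : {linear reduced_homology R K n ->
    (reduced_homology R K1 n * reduced_homology R K2 n)%type},
    f =1 fun q => (h1 q, h2 q).
  by apply: linear_ex => a q q'; rewrite !linearP.
exists f; exists (fun p => k1 p.1 + k2 p.2) => [q|[q1 q2]].
  have [z zK ->] := homology_class_ex q.
  rewrite fE /= h1E // h2E // k1E ?k2E ?(push_cycles r1K) ?(push_cycles r2K) //.
  rewrite -homology_classD; apply/esym/homology_class_eq => //.
    by rewrite memvD ?(push_cycles i1K, push_cycles i2K) //
       (push_cycles r1K, push_cycles r2K).
  by rewrite /= !push_comp opprD addrA wedge_defect_boundary.
have [z1 z1K ->] := homology_class_ex q1.
have [z2 z2K ->] := homology_class_ex q2.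
have [i1z i2z] := (push_cycles i1K z1K, push_cycles i2K z2K).
rewrite fE /= k1E // k2E // !linearD /= !h1E // !h2E //= !push_comp.
rewrite !(push_id _ r1i1) !(push_id _ r2i2).
(* The cross terms come from the constant composites, hence vanish. *)
rewrite (@homology_class0 _ _ K1 _ (push _ z2)); last first.
  exact: (push_const_boundary (y := x0) _ x0K z2K).
rewrite (@homology_class0 _ _ K2 _ (push _ z1)); last first.
  exact: (push_const_boundary (y := y0) _ y0K z1K).
by rewrite addr0 add0r.
Qed.

End WedgeHomology.

(** * Path distances, nonexpansive maps and Dowker complexes *)

Section PathDistanceTheory.
Variables (R : realType) (G H : wdigraph R).

Lemma path_weight_ge0 (x : G) p : (0 <= path_weight x p)%E.
Proof. by elim: p x => //= y p IHp x; rewrite adde_ge0 ?weight_ge0. Qed.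

Lemma dist_ge0 (x y : G) : (0 <= dist x y)%E.
Proof. by apply/ereal_infP => _ [p _ <-]; apply: path_weight_ge0. Qed.

Lemma dist_refl (x : G) : dist x x = 0%E.
Proof.
apply/eqP; rewrite eq_le dist_ge0 andbT; apply: ereal_inf_lbound.
by exists [::].
Qed.

(** A path is mapped edge by edge, and contracted edges are dropped. The first alternative is
    essential for retractions: the loop at the image point may be heavier than the contracted
    edge. *)
Lemma dist_nonexpansive (f : G -> H) :
    (forall u v, f u = f v \/ (weight (f u) (f v) <= weight u v)%E) ->
  forall u v, (dist (f u) (f v) <= dist u v)%E.
Proof.
move=> fw u v; apply/ereal_infP => _ [p <- <-].
have [q qp qw] : exists2 q, last (f u) q = f (last u p) &
    (path_weight (f u) q <= path_weight u p)%E.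
  elim: p u {v} => [|v p IHp] u; first by exists [::].
  have [q qp qw] := IHp v; have [fuv|fuv] := fw u v.
    exists q; rewrite fuv //; apply: le_trans qw _ => /=.
    by rewrite leeDr ?weight_ge0.
  by exists (f v :: q) => //=; apply: leeD.
by apply: le_trans qw; apply: ereal_inf_lbound; exists q.
Qed.

Lemma dowker_simplicial (delta : R) (f : G -> H) :
    (forall u v, (dist (f u) (f v) <= dist u v)%E) ->
  simplicial_map (dowker delta G) (dowker delta H) f.
Proof.
move=> fd s; rewrite !inE => /andP[/finset.set0Pn[x xs]].
move=> /existsP[y /forall_inP ys].
apply/andP; split; first by apply/finset.set0Pn; exists (f x); apply: imset_f.
apply/existsP; exists (f y); apply/forall_inP => _ /imsetP[v vs ->].
exact: le_trans (fd _ _) (ys v vs).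
Qed.

Lemma dowker_set1 (delta : R) (x : G) : 0 <= delta ->
  [set x]%SET \in simplices (dowker delta G).
Proof.
move=> d0; rewrite inE; apply/andP; split.
  by apply/finset.set0Pn; exists x; rewrite inE.
apply/existsP; exists x; apply/forall_inP => y; rewrite inE => /eqP->.
by rewrite dist_refl lee_fin.
Qed.

(** Nonnegative [delta] makes the base points simplices. For negative [delta] all complexes would be
    empty, with reduced homology of dimension 1 in degree -1, where the splitting fails. *)
Lemma shares_nbhd_ge0 (delta : R) (x v : G) :
  shares_nbhd delta x v -> 0 <= delta.
Proof.
by move=> [y [yx _]]; rewrite -lee_fin; apply: le_trans yx; apply: dist_ge0.
Qed.

End PathDistanceTheory.

(** * Inclusions and retractions of the wedge of networks *)

Section WedgeMaps.
Variables (R : realType) (G1 G2 : wdigraph R) (x0 : G1) (y0 : G2).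
Local Notation G := (wedge x0 y0).

Definition wedge_inl (x : G1) : G := inl x.
Definition wedge_inr (y : G2) : G :=
  if insub y is Some y' then inr y' else inl x0.
Definition wedge_retl (u : G) : G1 := if u is inl x then x else x0.
Definition wedge_retr (u : G) : G2 := if u is inr y then val y else y0.

Variant wedge_inr_spec (y : G2) : G -> Type :=
| WedgeInrBase of y = y0 : wedge_inr_spec y (inl x0)
| WedgeInr (y' : {y : G2 | y != y0}) of y = val y' : wedge_inr_spec y (inr y').

Lemma wedge_inrP y : wedge_inr_spec y (wedge_inr y).
Proof.
rewrite /wedge_inr; case: insubP => [y' _ <-|]; first exact: WedgeInr.
by rewrite negbK => /eqP; apply: WedgeInrBase.
Qed.

Lemma wedge_inr_val (y : {y : G2 | y != y0}) : wedge_inr (val y) = inr y.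
Proof. by rewrite /wedge_inr valK. Qed.

Lemma wedge_inr_base : wedge_inr y0 = inl x0.
Proof. by case: wedge_inrP => // y' y0y'; case/eqP: (valP y'). Qed.

Lemma wedge_inl_nonexpansive x x' :
  (dist (wedge_inl x) (wedge_inl x') <= dist x x')%E.
Proof.
apply: dist_nonexpansive => {}x {}x'; right => /=.
by case: ifP => // /andP[/eqP-> /eqP->]; rewrite ge_min lexx.
Qed.

Lemma wedge_inr_nonexpansive y y' :
  (dist (wedge_inr y) (wedge_inr y') <= dist y y')%E.
Proof.
apply: dist_nonexpansive => {}y {}y'.
case: wedge_inrP => [->|v ->]; case: wedge_inrP => [->|v' ->]; first by left.
- by right; rewrite /= eqxx.
- by right; rewrite /= eqxx.
- by right.
Qed.

(** Edges within the right graph are contracted; a crossing edge has infinite weight unless it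
    starts or ends at the wedge point, and then it is contracted. So is the loop there, which may be
    lighter than the loop at [x0]. *)
Lemma wedge_retl_nonexpansive u v :
  (dist (wedge_retl u) (wedge_retl v) <= dist u v)%E.
Proof.
apply: dist_nonexpansive => {u v} -[x|y] [x'|y'] /=.
- by case: ifP => [/andP[/eqP-> /eqP->]|_]; [left | right].
- by case: ifP => [/eqP->|_]; [left | right; rewrite leey].
- by case: ifP => [/eqP->|_]; [left | right; rewrite leey].
- by left.
Qed.

Lemma wedge_retr_nonexpansive u v :
  (dist (wedge_retr u) (wedge_retr v) <= dist u v)%E.
Proof.
apply: dist_nonexpansive => {u v} -[x|y] [x'|y'] /=.
- by left.
- by right; case: ifP => // _; rewrite leey.
- by right; case: ifP => // _; rewrite leey.
- by right.
Qed.

Lemma dowker_wedge_mixed (delta : R) (s : {set G}) :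
    s \in simplices (dowker delta G) ->
  [\/ (inl x0 : G) |: s \in simplices (dowker delta G),
      {in s, forall u, wedge_inl (wedge_retl u) = u /\ wedge_retr u = y0} |
      {in s, forall u, wedge_inr (wedge_retr u) = u /\ wedge_retl u = x0}].
Proof.
rewrite !inE => /andP[_ /existsP[w /forall_inP ws]].
have cone_s : (dist w (inl x0) <= delta%:E)%E ->
    ((inl x0 : G) |: s != finset.set0) &&
    [exists y : G, [forall x in (inl x0 : G) |: s, (dist y x <= delta%:E)%E]].
  move=> w0; apply/andP; split.
    by apply/finset.set0Pn; exists (inl x0 : G); apply: finset.setU11.
  apply/existsP; exists w; apply/forall_inP => v.
  by rewrite !inE => /orP[/eqP->//|/ws].
case: w ws cone_s => [x|y] ws cone_s.
  case: (boolP [exists y, (inr y : G) \in s]) => [/existsP[y ys]|noy].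
    (* The same center [w] serves for the cone: retracting left and including back fixes [w] and
       sends [y] to the wedge point, so the wedge point is no farther from [w] than [y] is. *)
    constructor 1; apply: cone_s; apply: le_trans (ws _ ys).
    apply: le_trans (wedge_retl_nonexpansive (inl x) (inr y)).
    exact: wedge_inl_nonexpansive.
  constructor 2 => -[//|y ys].
  by move: noy => /existsPn/(_ y); rewrite ys.
case: (boolP [exists x, (inl x : G) \in s]) => [/existsP[x xs]|nox].
  constructor 1; apply: cone_s; apply: le_trans (ws _ xs).
  apply: le_trans (wedge_retr_nonexpansive (inr y) (inl x)).
  apply: le_trans (wedge_inr_nonexpansive _ _).
  by rewrite wedge_inr_val wedge_inr_base.
constructor 3 => -[x xs|y' _]; last by rewrite wedge_inr_val.
by move: nox => /existsPn/(_ x); rewrite xs.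
Qed.

End WedgeMaps.

Theorem theorem19 (R : realType) (G1 G2 : wdigraph R) (x0 : G1) (y0 : G2)
    (delta : R)
    (hx0 : exists2 v : G1, v != x0 & shares_nbhd delta x0 v)
    (hy0 : exists2 v : G2, v != y0 & shares_nbhd delta y0 v)
    (n : int) :
  exists f : {linear reduced_homology R (dowker delta (wedge x0 y0)) n ->
                     (reduced_homology R (dowker delta G1) n *
                      reduced_homology R (dowker delta G2) n)%type},
    bijective f.
Proof.
have d0 : 0 <= delta by have [v _ /shares_nbhd_ge0] := hx0.
apply: (@wedge_homology R _ _ _ _ _ _ (inl x0 : wedge x0 y0) x0 y0
  (@wedge_inl _ _ _ x0 y0) (@wedge_inr _ _ _ x0 y0) (@wedge_retl _ _ _ x0 y0)
  (@wedge_retr _ _ _ x0 y0)) => //.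
- by apply: dowker_simplicial; apply: wedge_inl_nonexpansive.
- by apply: dowker_simplicial; apply: wedge_inr_nonexpansive.
- by apply: dowker_simplicial; apply: wedge_retl_nonexpansive.
- by apply: dowker_simplicial; apply: wedge_retr_nonexpansive.
- by move=> y /=; case: wedge_inrP.
- by move=> y; case: wedge_inrP.
- exact: wedge_inr_base.
- exact: dowker_set1.
- exact: dowker_set1.
- by move=> [x|y]; [left | right; rewrite wedge_inr_val].
- exact: dowker_wedge_mixed.
Qed.
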